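(* For every integer $k\geq 0$, one has $$\max_{|n|\leq M_k}L_n=L_{M_k}\quad\text{and}\quad \min_{|n|\geq M_k+1}L_n=L_{M_k+1},$$ where $n$ ranges over integers. Moreover, $$L_{M_k+1}-L_{M_k}=L_1.$$
   Context: Let $\alpha=\sqrt5-2$ and $r=\alpha^{1/2}$. For $x\in\mathbb R$ let $d(x)=\mathrm{dist}(x,\mathbb Z)$ denote the distance from $x$ to the nearest integer. For $n\in\mathbb Z$ let $$L_n=\sum_{j=1}^{\infty} r^{-j}\, d(\alpha^{j} n)$$ (this series converges for every $n$). Define integers $q_j$ by $q_{-1}=0$, $q_0=1$, $q_{j+1}=4q_j+q_{j-1}$ for $j\ge 0$, and set $M_k=q_0+q_1+\dots+q_k$ for $k\ge 0$. *)

(* Defs.v *)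
From Stdlib Require Import Reals ZArith Lra Lia.
From Coquelicot Require Import Coquelicot.
Open Scope R_scope.

Definition alpha : R := sqrt 5 - 2.

Definition r : R := sqrt alpha.

(* [Glb_Rbar] takes values in [Rbar]; [d_is_glb] below shows that the infimum
   is finite, so that [real] is harmless. *)
Definition d (x : R) : R :=
  real (Glb_Rbar (fun y => exists m : Z, y = Rabs (x - IZR m))).

(* The sum over j >= 1 is reindexed to start at 0.  [ex_series_L] below
   shows that the series converges for every [n]. *)
Definition L (n : Z) : R :=
  Series (fun i => / r ^ (S i) * d (alpha ^ (S i) * IZR n)).

(* The sequence q_{-1}, q_0, q_1, ..., with its index shifted by one. *)
Fixpoint qshift (i : nat) : Z :=
  match i with
  | O => 0
  | S i' =>
      match i' with
      | O => 1
      | S i'' => 4 * qshift i' + qshift i''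
      end
  end%Z.

Definition q (j : nat) : Z := qshift (S j).

Fixpoint M (k : nat) : Z :=
  match k with
  | O => q 0
  | S k' => (M k' + q (S k'))%Z
  end.

Definition is_max_on (A : Z -> Prop) (f : Z -> R) (v : R) : Prop :=
  (exists n, A n /\ f n = v) /\ (forall n, A n -> f n <= v).

Definition is_min_on (A : Z -> Prop) (f : Z -> R) (v : R) : Prop :=
  (exists n, A n /\ f n = v) /\ (forall n, A n -> v <= f n).

Lemma d_is_glb (x : R) :
  is_glb_Rbar (fun y => exists m : Z, y = Rabs (x - IZR m)) (d x).
Proof.
unfold d.
set (E := fun y => exists m : Z, y = Rabs (x - IZR m)).
destruct (Glb_Rbar_correct E) as [Hlb Hglb].
assert (H0 : Rbar_le 0 (Glb_Rbar E)).
{ apply Hglb. intros y [m ->]. apply Rabs_pos. }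
assert (H1 : Rbar_le (Glb_Rbar E) (Rabs (x - IZR 0))).
{ apply Hlb. now exists 0%Z. }
destruct (Glb_Rbar E) as [g| |]; simpl in *; try easy.
Qed.

Lemma d_ge0 (x : R) : 0 <= d x.
Proof.
apply (proj2 (d_is_glb x) 0). intros y [m ->]. apply Rabs_pos.
Qed.

Lemma d_le (x : R) (m : Z) : d x <= Rabs (x - IZR m).
Proof. apply (proj1 (d_is_glb x)). now exists m. Qed.

Lemma alpha_bounds : 0 < alpha < 1.
Proof.
unfold alpha.
assert (H := sqrt_sqrt 5 ltac:(lra)). assert (H' := sqrt_pos 5). nra.
Qed.

Lemma r_sqr : r * r = alpha.
Proof. apply sqrt_sqrt. destruct alpha_bounds; lra. Qed.

Lemma r_bounds : 0 < r < 1.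
Proof.
assert (Ha := alpha_bounds). assert (H := r_sqr).
assert (0 < r) by (apply sqrt_lt_R0; lra). nra.
Qed.

Lemma ex_series_L (n : Z) :
  ex_series (fun i => / r ^ (S i) * d (alpha ^ (S i) * IZR n)).
Proof.
assert (Hr := r_bounds).
apply (@ex_series_le R_AbsRing R_CompleteNormedModule
         _ (fun i => (Rabs (IZR n) * r) * r ^ i)).
- intro i. change norm with Rabs.
  assert (Hp : 0 < r ^ S i) by (apply pow_lt; lra).
  assert (Hi : 0 < / r ^ S i) by now apply Rinv_0_lt_compat.
  rewrite Rabs_pos_eq by (apply Rmult_le_pos; [lra | apply d_ge0]).
  assert (Hd := d_le (alpha ^ S i * IZR n) 0).
  rewrite Rminus_0_r, Rabs_mult, Rabs_pos_eq, <- r_sqr, Rpow_mult_distr in Hd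
    by (apply pow_le; destruct alpha_bounds; lra).
  rewrite <- r_sqr, Rpow_mult_distr.
  replace (Rabs (IZR n) * r * r ^ i)
    with (/ r ^ S i * (r ^ S i * r ^ S i * Rabs (IZR n)))
    by (simpl; field; split; [apply pow_nonzero|]; lra).
  apply Rmult_le_compat_l; lra.
- apply (@ex_series_scal_l R_AbsRing).
  apply ex_series_geom. rewrite Rabs_pos_eq; lra.
Qed.

(* Main.v *)
Require Import Defs.
From Stdlib Require Import Reals ZArith.
From Stdlib Require Import Lra Lia.
From Coquelicot Require Import Coquelicot.
Open Scope R_scope.

(** Replacing the integer [n] by a real [x] in the series of [L] gives a
    function [Lreal], and peeling off the first term gives the renormalization
    [Lreal x = F (alpha * x) / r] with [F = d + Lreal].  Multiplication by
    [alpha] almost preserves the sequence [0, M 0, M 1, ...], written [N]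
    below: [alpha * N (i + 1) = N i + e] where the offset [e] lies between
    [alpha - alpha ^ 2] and [alpha] ([offset_bounds]).

    Since [d x <= |x|] and [d] is subadditive, no function of this kind can
    grow faster than with slope [s = r / (1 - r)], the sum of the
    [r ^ (- j) * alpha ^ j]; and on each unit interval [[N i, N i + 1]] the
    function [Lreal] is affine with exactly this slope ([Lreal_gate]), because
    scaling by [alpha] sends that interval into the first half of
    [[N (i - 1), N (i - 1) + 1]], where [d] has slope 1 as well.  This is
    already the last claim, as [L 1 = s].  These intervals act as gates
    separating smaller values from larger ones, and both extremal claims
    follow by induction on [i], pulling a point [y] back to [alpha * y].

    For the minimum, [F y >= F (N i + 1)] for all real [y >= N i + 1]
    ([F_ge_after_gate]): the pullback of [N i + 1] lies at distance at most
    [2 * alpha] from the start of the previous gate, so the value of [F] there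
    is at most the value at the end of that gate, as [2 * r <= 1].

    For the maximum, [F y <= F (N i)] is false for real [y] slightly below
    [N i > 0], since [F] has slope [s - 1 < 0] there; but it holds up to the
    error [(1 - s) / 2] ([F_le_before_gate]), and this error is absorbed by
    the rise of [F] over the offset [e] when one passes from real points to
    integers ([L_le_before_gate]). *)

(** * Distance to the nearest integer *)

Lemma d_near (x : R) (m : Z) :
  Rabs (x - IZR m) <= 1 / 2 -> d x = Rabs (x - IZR m).
Proof.
intro H. apply Rle_antisym; [apply d_le|].
apply (proj2 (d_is_glb x) (Finite (Rabs (x - IZR m)))). intros y [p ->]. simpl.
assert (Hp : (p <= m - 1 \/ p = m \/ m + 1 <= p)%Z) by lia.
destruct Hp as [Hp|[->|Hp]]; [|lra|]; apply IZR_le in Hp;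
  rewrite ?plus_IZR, ?minus_IZR in Hp; revert H;
  unfold Rabs; repeat destruct Rcase_abs; lra.
Qed.

Lemma d_rise (m : Z) (t : R) : 0 <= t <= 1 / 2 -> d (IZR m + t) = t.
Proof.
intro Ht.
assert (E : Rabs (IZR m + t - IZR m) = t) by (rewrite Rabs_pos_eq; lra).
rewrite (d_near _ m); lra.
Qed.

Lemma d_fall (m : Z) (t : R) : 1 / 2 <= t <= 1 -> d (IZR m + t) = 1 - t.
Proof.
intro Ht.
assert (E : Rabs (IZR m + t - IZR (m + 1)) = 1 - t)
  by (rewrite plus_IZR, Rabs_left1; lra).
rewrite (d_near _ (m + 1)); lra.
Qed.

Lemma d_IZR (m : Z) : d (IZR m) = 0.
Proof. rewrite <- (Rplus_0_r (IZR m)). apply d_rise. lra. Qed.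

Lemma d_le_half (x : R) : d x <= 1 / 2.
Proof.
assert (H := d_le x (up (x - 1 / 2))).
destruct (archimed (x - 1 / 2)) as [H1 H2].
apply Rle_trans with (1 := H), Rabs_le. lra.
Qed.

Lemma d_opp (x : R) : d (- x) = d x.
Proof.
assert (H : forall y, d (- y) <= d y).
{ intro y. apply (proj2 (d_is_glb y) (Finite (d (- y)))). intros z [m ->]. simpl.
  replace (y - IZR m) with (- (- y - IZR (- m))) by (rewrite opp_IZR; ring).
  rewrite Rabs_Ropp. apply d_le. }
apply Rle_antisym; [apply H|]. rewrite <- (Ropp_involutive x) at 1. apply H.
Qed.

(** * The constants *)

Lemma alpha_quadratic : alpha * alpha = 1 - 4 * alpha.
Proof.
unfold alpha. assert (H := sqrt_sqrt 5 ltac:(lra)). lra.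
Qed.

Lemma alpha_approx : 0.236 < alpha < 0.2361.
Proof. assert (H := alpha_quadratic). assert (Ha := alpha_bounds). nra. Qed.

Lemma r_approx : 0.48 < r < 0.49.
Proof. assert (H := r_sqr). assert (Ha := alpha_approx). assert (Hr := r_bounds). nra. Qed.

Definition s : R := r / (1 - r).

(** The renormalization turns slope [1 + s] of [F] into slope [s] of
    [Lreal]; this is why [s] is the slope of a gate at every scale. *)
Lemma s_fixed : / r * ((1 + s) * alpha) = s.
Proof.
assert (Hr := r_approx). rewrite <- r_sqr. unfold s. field. lra.
Qed.

Lemma s_bounds : 0 < s < 1.
Proof.
assert (Hr := r_approx). unfold s. split.
- apply Rdiv_lt_0_compat; lra.
- apply Rlt_div_l; lra.
Qed.

(** * The renormalization *)

Definition Lreal (x : R) : R :=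
  Series (fun i => / r ^ (S i) * d (alpha ^ (S i) * x)).

Definition F (x : R) : R := d x + Lreal x.

Lemma rescale_pow (j : nat) : / r ^ j * alpha ^ j = r ^ j.
Proof.
assert (Hr := r_bounds).
rewrite <- r_sqr, Rpow_mult_distr. field. apply pow_nonzero. lra.
Qed.

Lemma ex_series_Lreal (x : R) :
  ex_series (fun i => / r ^ (S i) * d (alpha ^ (S i) * x)).
Proof.
assert (Hr := r_bounds). assert (Ha := alpha_bounds).
apply (@ex_series_le R_AbsRing R_CompleteNormedModule
         _ (fun i => (Rabs x * r) * r ^ i)).
- intro i. change norm with Rabs.
  assert (Hi : 0 < / r ^ S i) by (apply Rinv_0_lt_compat, pow_lt; lra).
  rewrite Rabs_pos_eq by (apply Rmult_le_pos; [lra | apply d_ge0]).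
  assert (Hd := d_le (alpha ^ S i * x) 0).
  rewrite Rminus_0_r, Rabs_mult, (Rabs_pos_eq (alpha ^ S i)) in Hd
    by (apply pow_le; lra).
  replace (Rabs x * r * r ^ i) with (/ r ^ S i * (alpha ^ S i * Rabs x))
    by (rewrite <- Rmult_assoc, rescale_pow; simpl; ring).
  apply Rmult_le_compat_l; lra.
- apply (@ex_series_scal_l R_AbsRing).
  apply ex_series_geom. rewrite Rabs_pos_eq; lra.
Qed.

Lemma Lreal_renorm (x : R) : Lreal x = / r * F (alpha * x).
Proof.
assert (Hr := r_bounds). unfold F, Lreal.
rewrite (Series_incr_1 _ (ex_series_Lreal x)).
rewrite Rmult_plus_distr_l, <- Series_scal_l. f_equal.
- now rewrite !pow_1.
- apply Series_ext. intro i.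
  replace (alpha ^ S (S i) * x) with (alpha ^ S i * (alpha * x)) by (simpl; ring).
  change (r ^ S (S i)) with (r * r ^ S i). rewrite Rinv_mult. ring.
Qed.

Lemma F_renorm (x : R) : F x = d x + / r * F (alpha * x).
Proof. unfold F at 1. now rewrite Lreal_renorm. Qed.

Lemma F_IZR (n : Z) : F (IZR n) = L n.
Proof. unfold F. rewrite d_IZR. apply Rplus_0_l. Qed.

Lemma L_opp (n : Z) : L (- n) = L n.
Proof.
apply Series_ext. intro i.
now rewrite opp_IZR, Ropp_mult_distr_r_reverse, d_opp.
Qed.

Lemma L_abs (n : Z) : L (Z.abs n) = L n.
Proof. destruct (Z.abs_spec n) as [[_ ->]|[_ ->]]; [|rewrite L_opp]; reflexivity. Qed.

(** On [[0, 1]] all the [alpha ^ j * t] stay below 1/2, so that [d] is the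
    identity on them and the series is geometric. *)
Lemma Lreal_unit (t : R) : 0 <= t <= 1 -> Lreal t = s * t.
Proof.
intro Ht. assert (Hr := r_bounds). assert (Ha := alpha_approx).
unfold Lreal. rewrite (Series_ext _ (fun i => r * t * r ^ i)).
- rewrite Series_scal_l, Series_geom by (rewrite Rabs_pos_eq; lra).
  unfold s. field. lra.
- intro i.
  assert (Hp : 0 <= alpha ^ i) by (apply pow_le; lra).
  assert (Hp' : alpha ^ i <= 1) by (rewrite <- (pow1 i); apply pow_incr; lra).
  assert (Hd : d (0 + alpha ^ S i * t) = alpha ^ S i * t).
  { apply (d_rise 0). simpl.
    assert (0 <= alpha * alpha ^ i <= 1 / 2) by nra. nra. }
  rewrite Rplus_0_l in Hd.
  rewrite Hd, <- Rmult_assoc, rescale_pow. simpl. ring.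
Qed.

(** * The gates *)

(** The sums [M] shifted by one index: starting from the empty sum lets every
    induction below start at [0], where [F] is explicit. *)
Definition N (i : nat) : Z := match i with O => 0%Z | S k => M k end.

Definition offset (i : nat) : R := alpha * IZR (N (S i)) - IZR (N i).

Lemma N_rec (i : nat) : N (S (S i)) = (4 * N (S i) + N i + 1)%Z.
Proof.
(* Adding up the recurrence of [q] gives the relation with [q]. *)
assert (H : forall k, (4 * M k = q (S k) + q k - 1)%Z).
{ induction k as [|k IH]; [reflexivity|].
  change (M (S k)) with (M k + q (S k))%Z.
  change (q (S (S k))) with (4 * q (S k) + q k)%Z. lia. }
destruct i as [|k]; [reflexivity|].
assert (H1 := H k). assert (H2 := H (S k)).
simpl N. change (M (S k)) with (M k + q (S k))%Z in *.
change (M (S (S k))) with (M k + q (S k) + q (S (S k)))%Z.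
lia.
Qed.

Lemma N_ge0 (i : nat) : (0 <= N i)%Z.
Proof.
assert (H : (0 <= N i /\ 0 <= N (S i))%Z).
{ induction i as [|i [IH IH']]; [simpl; unfold q; simpl; lia|].
  rewrite N_rec. lia. }
apply H.
Qed.

Lemma offset_rec (i : nat) : offset (S i) = alpha * (1 - offset i).
Proof.
unfold offset. rewrite N_rec, !plus_IZR, mult_IZR.
assert (H := alpha_quadratic).
replace (alpha * (1 - (alpha * IZR (N (S i)) - IZR (N i)))) with
  (alpha * (1 + IZR (N i)) - alpha * alpha * IZR (N (S i))) by ring.
rewrite H. ring.
Qed.

Lemma offset_bounds (i : nat) : alpha - alpha * alpha <= offset i <= alpha.
Proof.
assert (Ha := alpha_approx).
induction i as [|i IH].
- unfold offset. simpl. unfold q. simpl. nra.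
- rewrite offset_rec. nra.
Qed.

Lemma offset_eq (i : nat) : alpha * IZR (N (S i)) = IZR (N i) + offset i.
Proof. unfold offset. ring. Qed.

(** Scaling by [alpha] sends the gate at [N (i + 1)] into the first half of
    the gate at [N i], since [offset i + alpha <= 2 * alpha < 1 / 2]. *)
Lemma Lreal_gate (i : nat) (t : R) :
  0 <= t <= 1 -> Lreal (IZR (N i) + t) = Lreal (IZR (N i)) + s * t.
Proof.
revert t. induction i as [|i IH]; intros t Ht.
- simpl. rewrite Rplus_0_l, !Lreal_unit; lra.
- assert (Ha := alpha_approx). assert (He := offset_bounds i).
  rewrite !Lreal_renorm, Rmult_plus_distr_l, offset_eq, Rplus_assoc.
  unfold F. rewrite !d_rise, !IH by nra.
  rewrite <- s_fixed at 3. ring.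
Qed.

Lemma F_rise (i : nat) (t : R) :
  0 <= t <= 1 / 2 -> F (IZR (N i) + t) = F (IZR (N i)) + (1 + s) * t.
Proof.
intro Ht. unfold F. rewrite d_rise, d_IZR, Lreal_gate by lra. ring.
Qed.

Lemma F_fall (i : nat) (t : R) :
  1 / 2 <= t <= 1 -> F (IZR (N i) + t) = F (IZR (N i)) + s * t + (1 - t).
Proof.
intro Ht. unfold F. rewrite d_fall, d_IZR, Lreal_gate by lra. ring.
Qed.

Lemma F_N_succ (i : nat) :
  F (IZR (N (S i))) = / r * (F (IZR (N i)) + (1 + s) * offset i).
Proof.
assert (Ha := alpha_approx). assert (He := offset_bounds i).
rewrite F_renorm, d_IZR, offset_eq, F_rise by nra. ring.
Qed.

(** * Before a gate *)

(** A point [N (i + 1) - x] whose pullback still lies in the gate at [N i]. *)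
Lemma F_just_before (i : nat) (x : R) :
  0 <= x -> alpha * x <= offset i ->
  F (IZR (N (S i)) - x) = d (IZR (N (S i)) - x) + F (IZR (N (S i))) - s * x.
Proof.
intros Hx Hax. assert (Ha := alpha_approx). assert (He := offset_bounds i).
rewrite (F_renorm (_ - x)), F_N_succ.
replace (alpha * (IZR (N (S i)) - x)) with (IZR (N i) + (offset i - alpha * x))
  by (rewrite Rmult_minus_distr_l, offset_eq; ring).
rewrite F_rise by nra. rewrite <- s_fixed at 3. ring.
Qed.

Lemma F_le_before_gate (i : nat) (y : R) :
  0 <= y <= IZR (N i) -> F y <= F (IZR (N i)) + (1 - s) / 2.
Proof.
assert (Hs := s_bounds). assert (Ha := alpha_approx). assert (Hr := r_approx).
revert y. induction i as [|i IH]; intros y Hy.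
- replace y with (IZR (N 0)) by (simpl in *; lra). lra.
- set (x := IZR (N (S i)) - y).
  assert (He := offset_bounds i).
  destruct (Rle_lt_dec (alpha * x) (offset i)) as [Hx|Hx].
  + replace y with (IZR (N (S i)) - x) by (unfold x; ring).
    rewrite F_just_before by (unfold x in *; lra).
    assert (H1 := d_le_half (IZR (N (S i)) - x)).
    assert (H2 := d_le (IZR (N (S i)) - x) (N (S i))).
    rewrite Rabs_left1 in H2 by (unfold x; lra). nra.
  + assert (Hy' : 0 <= alpha * y <= IZR (N i)).
    { split; [nra|]. assert (H := offset_eq i). unfold x in Hx. lra. }
    specialize (IH _ Hy'). rewrite F_renorm, F_N_succ.
    assert (H1 := d_le_half y).
    assert (Hi : 0 < / r) by (apply Rinv_0_lt_compat; lra).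
    apply Rmult_le_compat_l with (r := / r) in IH; [|lra].
    (* Clearing denominators, this is [(1 - r) ^ 2 <= 2 * offset i]. *)
    assert (H2 : 0 <= / r * (1 + s) * offset i + (1 - s) / 2
                      - / r * ((1 - s) / 2) - 1 / 2).
    { replace (/ r * (1 + s) * offset i + (1 - s) / 2
                 - / r * ((1 - s) / 2) - 1 / 2)
        with ((2 * offset i - (1 - r) * (1 - r)) / (2 * r * (1 - r)))
        by (unfold s; field; lra).
      apply Rdiv_le_0_compat; nra. }
    lra.
Qed.

(** At an integer the term [d] vanishes, so the error made by pulling back
    only once is [(1 - s) / 2], which is less than the rise
    [(1 + s) * offset i]. *)
Lemma L_le_before_gate (i : nat) (n : Z) :
  (0 <= n <= N (S i))%Z -> L n <= L (N (S i)).
Proof.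
intros [Hn0 Hn]. apply IZR_le in Hn0. apply IZR_le in Hn.
assert (Hs := s_bounds). assert (Ha := alpha_approx). assert (Hr := r_approx).
assert (He := offset_bounds i).
rewrite <- !F_IZR.
set (x := IZR (N (S i)) - IZR n).
destruct (Rle_lt_dec (alpha * x) (offset i)) as [Hx|Hx].
- assert (H := F_just_before i x ltac:(unfold x; lra) Hx).
  replace (IZR (N (S i)) - x) with (IZR n) in H by (unfold x; ring).
  rewrite d_IZR in H. unfold x in *. nra.
- assert (Hy' : 0 <= alpha * IZR n <= IZR (N i)).
  { split; [nra|]. assert (H := offset_eq i). unfold x in Hx. lra. }
  assert (H := F_le_before_gate i _ Hy').
  rewrite F_renorm, d_IZR, F_N_succ, Rplus_0_l.
  apply Rmult_le_compat_l; [left; apply Rinv_0_lt_compat; lra|].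
  assert (1 - s < 0.1).
  { unfold s. replace (1 - r / (1 - r)) with ((1 - 2 * r) / (1 - r)) by (field; lra).
    apply Rlt_div_l; lra. }
  nra.
Qed.

(** * After a gate *)

(** [F] increases on the first half of the gate and decreases slightly on the
    second; the value at [2 * alpha] does not exceed the value at the end,
    because [(1 + s) * (2 * alpha) <= s] means [2 * r <= 1]. *)
Lemma F_le_later_in_gate (i : nat) (u t : R) :
  0 <= u <= 2 * alpha -> u <= t <= 1 -> F (IZR (N i) + u) <= F (IZR (N i) + t).
Proof.
intros Hu Ht.
assert (Hs := s_bounds). assert (Ha := alpha_approx). assert (Hr := r_approx).
rewrite (F_rise i u) by lra.
destruct (Rle_lt_dec t (1 / 2)) as [H|H].
- rewrite F_rise by lra. nra.
- rewrite F_fall by lra.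
  assert (Hf : (1 + s) * (2 * alpha) <= s).
  { assert (Hf := s_fixed). apply (f_equal (Rmult r)) in Hf.
    rewrite <- Rmult_assoc, Rinv_r, Rmult_1_l in Hf by lra. nra. }
  nra.
Qed.

(** The case of the gate at 0, which [x -> alpha * x] maps into itself: here
    the induction is on the number of scalings that bring [y] down to at most 1. *)
Lemma F_ge_after_first_gate (y : R) : 1 <= y -> F 1 <= F y.
Proof.
assert (Hs := s_bounds). assert (Ha := alpha_approx). assert (Hr := r_approx).
assert (Hi : 1 < / r) by (rewrite <- Rinv_1; apply Rinv_lt_contravar; lra).
assert (F1 : F 1 = s) by (unfold F; rewrite (d_IZR 1), Lreal_unit; lra).
intro Hy.
assert (Hj : exists j : nat, alpha ^ j * y <= 1).
{ destruct (pow_lt_1_zero alpha) with (y := / y) as [j Hj].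
  - rewrite Rabs_pos_eq; lra.
  - apply Rinv_0_lt_compat; lra.
  - exists j. specialize (Hj j (Nat.le_refl j)).
    rewrite Rabs_pos_eq in Hj by (apply pow_le; lra).
    apply Rmult_le_reg_r with (/ y); [apply Rinv_0_lt_compat; lra|].
    rewrite Rmult_assoc, Rinv_r by lra. lra. }
destruct Hj as [j Hj]. revert y Hy Hj.
induction j as [|j IH]; intros y Hy Hj.
- replace y with 1 by (simpl in Hj; lra). lra.
- rewrite (F_renorm y). assert (Hd := d_ge0 y).
  destruct (Rle_lt_dec 1 (alpha * y)) as [H|H].
  + assert (IH' := IH (alpha * y) H ltac:(simpl in Hj; lra)). nra.
  + assert (G := F_le_later_in_gate 0 alpha (alpha * y) ltac:(lra) ltac:(nra)).
    simpl in G. rewrite !Rplus_0_l in G.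
    rewrite (F_renorm 1), (d_IZR 1), Rmult_1_r. nra.
Qed.

Lemma F_ge_after_gate (i : nat) (y : R) :
  IZR (N i) + 1 <= y -> F (IZR (N i) + 1) <= F y.
Proof.
assert (Ha := alpha_approx). assert (Hr := r_approx).
revert y. induction i as [|i IH]; intros y Hy.
- simpl in *. rewrite Rplus_0_l in *. now apply F_ge_after_first_gate.
- assert (He := offset_bounds i).
  rewrite (F_renorm y), (F_renorm (_ + 1)), <- plus_IZR, d_IZR, plus_IZR.
  assert (Hd := d_ge0 y).
  assert (Hi : 0 < / r) by (apply Rinv_0_lt_compat; lra).
  rewrite Rmult_plus_distr_l, offset_eq, Rmult_1_r, Rplus_assoc.
  assert (Hy' : IZR (N i) + (offset i + alpha) <= alpha * y).
  { rewrite <- Rplus_assoc, <- offset_eq. nra. }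
  enough (F (IZR (N i) + (offset i + alpha)) <= F (alpha * y)) by nra.
  destruct (Rle_lt_dec (IZR (N i) + 1) (alpha * y)) as [H|H].
  + apply Rle_trans with (2 := IH _ H). apply F_le_later_in_gate; nra.
  + replace (alpha * y) with (IZR (N i) + (alpha * y - IZR (N i))) by ring.
    apply F_le_later_in_gate; nra.
Qed.

Theorem proposition1p4 : forall k : nat,
  is_max_on (fun n : Z => (Z.abs n <= M k)%Z) L (L (M k)) /\
  is_min_on (fun n : Z => (Z.abs n >= M k + 1)%Z) L (L (M k + 1)%Z) /\
  L (M k + 1)%Z - L (M k) = L 1%Z.
Proof.
intro k. assert (HM := N_ge0 (S k)). simpl in HM.
split; [|split].
- split.
  + exists (M k). split; [lia|reflexivity].
  + intros n Hn. rewrite <- L_abs.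
    apply (L_le_before_gate k). simpl. lia.
- split.
  + exists (M k + 1)%Z. split; [lia|reflexivity].
  + intros n Hn. rewrite <- (L_abs n), <- !F_IZR, plus_IZR.
    apply (F_ge_after_gate (S k)). change (N (S k)) with (M k).
    rewrite <- plus_IZR. apply IZR_le. lia.
- assert (H := Lreal_gate (S k) 1 ltac:(lra)).
  assert (H1 := Lreal_unit 1 ltac:(lra)).
  change (N (S k)) with (M k) in H. rewrite <- plus_IZR in H.
  change (Lreal (IZR ?n)) with (L n) in *. lra.
Qed.
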